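(* Let $L$ be a lattice and let $Y$ be a sublattice of $L$ satisfying Properties (A) and (B). Let $i:\mathrm{DM}(Y)\to \mathrm{DM}(L)$ be the map $i(A)=A^{+-}$. Then $i[\mathrm{DM}(Y)]$ is a regular sublattice of $\mathrm{DM}(L)$.
   Context: For a poset $P$ and $D\subseteq P$, $D^{+}$ and $D^{-}$ denote the sets of upper bounds and lower bounds of $D$ in $P$, and $D^{+-}=(D^{+})^{-}$. The Dedekind–MacNeille completion $\mathrm{DM}(P)$ is the set of all $D\subseteq P$ with $D=D^{+-}$, ordered by inclusion; it is a complete lattice. For a sublattice $Y$ of a lattice $L$ (a subset closed under the binary joins and meets of $L$) and $D\subseteq Y$, the symbols $D^{+},D^{-}$ are taken in $L$; put $D^{+_Y}=D^{+}\cap Y$ and $D^{-_Y}=D^{-}\cap Y$. Thus elements of $\mathrm{DM}(Y)$ are the $A\subseteq Y$ with $A=A^{+_Y-_Y}$, and in $i(A)=A^{+-}$ the operations are taken in $L$. The map $i$ is an order-embedding. $Y$ has Property (A) if for every $A\subseteq Y$ and every $x\in A^{-}$ there exists $y\in A^{-}\cap Y$ with $x\le y$. $Y$ has Property (B) if for every $A\subseteq Y$ and every $x\in A^{+}$ there exists $y\in A^{+}\cap Y$ with $x\ge y$. A sublattice $K$ of a lattice $M$ is regular if the inclusion of $K$ in $M$ preserves arbitrary infima and suprema, i.e. whenever a subset of $K$ has a supremum (resp. infimum) in $K$, this element is also its supremum (resp. infimum) in $M$. *)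

(* Defs.v *)
From HB Require Import structures.
From mathcomp Require Import all_boot all_order.
From mathcomp Require Import boolp classical_sets.

Set Implicit Arguments.
Unset Strict Implicit.
Unset Printing Implicit Defensive.

Import Order.TTheory.

Local Open Scope order_scope.
Local Open Scope classical_set_scope.

(* Subsets, including those whose suprema and infima are taken, may be empty;
   lattices need not be bounded or nonempty. *)

Section Closure.
Context {d : Order.disp_t} {P : porderType d}.
Implicit Types D E : set P.

(* [D^{+-}]; [ubound] and [lbound] are [^+] and [^-]. *)
Definition cl D : set P := lbound (ubound D).

Lemma sub_cl D : D `<=` cl D.
Proof. by move=> x Dx y; apply. Qed.

Lemma cl_mono D E : D `<=` E -> cl D `<=` cl E.
Proof. by move=> DE x Dx y Ey; apply: Dx => z /DE; apply: Ey. Qed.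

Lemma cl_idem D : cl (cl D) = cl D.
Proof.
apply/seteqP; split; last exact: sub_cl.
by move=> x Hx y Dy; apply: Hx => z; apply.
Qed.

End Closure.

(* The condition is wrapped in [asbool] only to fit the [subType] interface. *)
Record DM {d : Order.disp_t} (P : porderType d) :=
  MkDM { dm_val :> set P; dm_valP : `[< dm_val = cl dm_val >] }.

HB.instance Definition _ d (P : porderType d) := [isSub for @dm_val d P].
HB.instance Definition _ d (P : porderType d) := [Choice of DM P by <:].
(* The order inherited from [set P] is inclusion. *)
HB.instance Definition _ d (P : porderType d) :=
  [SubChoice_isSubPOrder of DM P by <: with set_display].

Section DMLattice.
Context {d : Order.disp_t} {P : porderType d}.
Implicit Types D E F : DM P.

Lemma dm_eq D : dm_val D = cl D.
Proof. exact/asboolP/dm_valP. Qed.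

Lemma dm_leP D E : (D <= E) = (dm_val D `<=` dm_val E) :> Prop.
Proof. by rewrite -subsetEset. Qed.

Lemma dm_cl_subproof (A : set P) : `[< cl A = cl (cl A) >].
Proof. by apply/asboolP; rewrite cl_idem. Qed.

Definition dm_cl (A : set P) : DM P := MkDM (dm_cl_subproof A).

Lemma dm_meet_subproof D E :
  `[< dm_val D `&` dm_val E = cl (dm_val D `&` dm_val E) >].
Proof.
apply/asboolP/seteqP; split; first exact: sub_cl.
move=> x Hx; split; [rewrite (dm_eq D)|rewrite (dm_eq E)];
  by apply: cl_mono Hx => y [].
Qed.

Definition dm_meet D E : DM P := MkDM (dm_meet_subproof D E).
Definition dm_join D E : DM P := dm_cl (dm_val D `|` dm_val E).

Lemma dm_meetP D E F : (D <= dm_meet E F) = (D <= E) && (D <= F).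
Proof.
apply/idP/andP => [|[]]; rewrite !dm_leP /=.
  by move=> DEF; split => x /DEF [].
by move=> DE DF x Dx; split; [apply: DE|apply: DF].
Qed.

Lemma dm_joinP D E F : (dm_join D E <= F) = (D <= F) && (E <= F).
Proof.
apply/idP/andP => [|[]]; rewrite !dm_leP /=.
  by move=> DEF; split => x ?; apply/DEF/sub_cl; [left|right].
by move=> DF EF; rewrite (dm_eq F); apply: cl_mono => x [/DF|/EF].
Qed.

End DMLattice.

HB.instance Definition _ d (P : porderType d) :=
  Order.POrder_MeetJoin_isLattice.Build set_display (DM P)
    (@dm_meetP d P) (@dm_joinP d P).

Section Sublattice.
Context {d : Order.disp_t} {M : latticeType d}.
Implicit Types K S : set M.

Definition is_sublattice K :=
  forall x y, K x -> K y -> K (x `&` y)%O /\ K (x `|` y)%O.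

(* Supremum and infimum of [S] in the subposet [K] of [M]. *)
Definition is_sup_in K S x :=
  [/\ K x, ubound S x & forall y, K y -> ubound S y -> x <= y].

Definition is_inf_in K S x :=
  [/\ K x, lbound S x & forall y, K y -> lbound S y -> y <= x].

Definition is_regular_sublattice K :=
  is_sublattice K /\
  forall S, S `<=` K ->
    (forall x, is_sup_in K S x -> supremums S x) /\
    (forall x, is_inf_in K S x -> infimums S x).

End Sublattice.

Section Embedding.
Context {d : Order.disp_t} {L : latticeType d}.
Implicit Types Y A : set L.

Definition propertyA Y := forall A, A `<=` Y ->
  forall x, lbound A x -> exists2 y, (lbound A `&` Y) y & x <= y.

Definition propertyB Y := forall A, A `<=` Y ->
  forall x, ubound A x -> exists2 y, (ubound A `&` Y) y & y <= x.

(* [A^{+_Y -_Y}], with bounds taken in [L] and then restricted to [Y]. *)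
Definition cl_in Y A : set L := lbound (ubound A `&` Y) `&` Y.

(* The elements of [DM(Y)], as subsets of [L] contained in [Y]. *)
Definition DM_in Y : set (set L) := [set A | A `<=` Y /\ A = cl_in Y A].

(* [i : DM(Y) -> DM(L)], [A |-> A^{+-}] with bounds in [L]; the domain is the
   subtype of [set L] carved out by [DM_in Y]. *)
Definition dm_map Y (A : DM_in Y) : DM L := dm_cl (\val A).

End Embedding.

(* Main.v *)
Require Import Defs.
From mathcomp Require Import all_boot all_order.
From mathcomp Require Import boolp classical_sets.

(** Write K for the image of [dm_map].  The point is that K is closed under
    all suprema and infima of DM(L); since DM(L) is complete, a supremum or
    infimum taken inside K must then agree with the one taken in DM(L), and
    binary meets and joins are special cases.

    The closure properties come from two descriptions of the members D of K.
    They are the cuts generated from below by their elements in Y, that is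
    D = (D `&` Y)^{+-} ([range_dm_mapP]), and, dually, the cuts that are the
    lower bounds of their upper bounds in Y ([range_dm_map_lboundP]).
    Property (B) says that upper bounds in Y of a subset of Y are coinitial
    among all its upper bounds, so that the two kinds of upper bounds
    have the same lower bounds; property (A) is the dual, and together they
    make the two descriptions equivalent.  The first description is visibly
    stable under suprema, the second one under infima. *)

Import Order.TTheory.

Local Open Scope order_scope.
Local Open Scope classical_set_scope.

Lemma lbound_mono {d : Order.disp_t} {P : porderType d} (A B : set P) :
  A `<=` B -> lbound B `<=` lbound A.
Proof. by move=> AB x Bx y /AB; apply: Bx. Qed.

Section Completeness.
Context {d : Order.disp_t} {P : porderType d}.
Implicit Types (S : set (DM P)) (D E F : DM P).

Lemma dm_cl_le (A : set P) F : A `<=` F -> dm_cl A <= F.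
Proof. by move=> AF; rewrite dm_leP (dm_eq F); apply: cl_mono. Qed.

Lemma dm_supremum_exists S : exists F, supremums S F.
Proof.
exists (dm_cl (\bigcup_(D in S) dm_val D)); split=> [D SD|F SF].
  by rewrite dm_leP => x Dx; apply: sub_cl; exists D.
by apply: dm_cl_le => x [D /SF]; rewrite dm_leP; apply.
Qed.

Lemma dm_infimum_exists S : exists F, infimums S F.
Proof.
have [F [Fub Fmin]] := dm_supremum_exists (lbound S).
by exists F; split=> // D SD; apply: Fmin => E; apply.
Qed.

Lemma dm_join_supremum D E : supremums [set D; E] (dm_join D E).
Proof.
have := lexx (dm_join D E); rewrite dm_joinP => /andP[DJ EJ].
split=> [F [->|->] //|F DEF].
by rewrite dm_joinP !DEF //; [right|left].
Qed.

Lemma dm_meet_infimum D E : infimums [set D; E] (dm_meet D E).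
Proof.
have := lexx (dm_meet D E); rewrite dm_meetP => /andP[MD ME].
split=> [F [->|->] //|F DEF].
by rewrite dm_meetP !DEF //; [right|left].
Qed.

End Completeness.

(** The ambient supremum of [S] lies in [K], so a supremum of [S] in [K] lies
    below it, hence below every upper bound of [S]; dually for infima. *)
Lemma dm_regular_of_closed {d : Order.disp_t} {P : porderType d}
    (K : set (DM P)) :
  (forall S, S `<=` K -> supremums S `<=` K) ->
  (forall S, S `<=` K -> infimums S `<=` K) ->
  is_regular_sublattice K.
Proof.
move=> supK infK; split=> [D E KD KE|S SK].
  have DEK : [set D; E] `<=` K by move=> F [->|->].
  split; first exact: infK DEK _ (dm_meet_infimum D E).
  exact: supK DEK _ (dm_join_supremum D E).
split=> D [_ boundD extD].
  have [F [Fub Fmin]] := dm_supremum_exists S.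
  split=> // G /Fmin; apply: le_trans; apply: extD => //.
  exact: (supK S SK).
have [F [Flb Fmax]] := dm_infimum_exists S.
split=> // G /Fmax GF; apply: le_trans GF _; apply: extD => //.
exact: (infK S SK).
Qed.

Section Image.
Context {d : Order.disp_t} {L : latticeType d} {Y : set L}.
Hypotheses (YA : propertyA Y) (YB : propertyB Y).
Implicit Types (A : set L) (D F : DM L) (S : set (DM L)).

Lemma lbound_ubound_in A : A `<=` Y -> lbound (ubound A `&` Y) `<=` cl A.
Proof.
move=> AY x xlb u Au; have [y AYy yu] := YB _ AY _ Au.
exact: le_trans (xlb _ AYy) yu.
Qed.

Lemma ubound_lbound_in A :
  A `<=` Y -> ubound (lbound A `&` Y) `<=` ubound (lbound A).
Proof.
move=> AY u uub x Ax; have [y AYy xy] := YA _ AY _ Ax.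
exact: le_trans xy (uub _ AYy).
Qed.

(** When [D] is in the image of [dm_map], this trace is its preimage.  By (B),
    an element of [Y] below all upper bounds of the trace in [Y] is below all
    of its upper bounds, hence in [D]. *)
Lemma trace_DM_in D : DM_in Y (D `&` Y).
Proof.
split=> [x []//|]; apply/seteqP; split=> x [].
  by move=> Dx Yx; split=> // u [uub _]; apply: uub.
move=> xlb Yx; split=> //; rewrite (dm_eq D).
have DYx : cl (D `&` Y) x by apply: lbound_ubound_in => // z [].
by apply: cl_mono DYx => z [].
Qed.

Lemma range_dm_mapP D :
  range (@dm_map d L Y) D <-> D `<=` cl (D `&` Y).
Proof.
split=> [[A _ <-] /=|Dcl].
  have [AY _] := set_valP A.
  by apply: cl_mono => x Ax; split; [apply: sub_cl|apply: AY].
exists (SigSub (mem_set (trace_DM_in D))) => //.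
apply/le_anti/andP; split; last by rewrite dm_leP.
by apply: dm_cl_le => x [].
Qed.

Lemma range_dm_map_lboundP D :
  range (@dm_map d L Y) D <-> lbound (ubound D `&` Y) `<=` D.
Proof.
rewrite range_dm_mapP; split=> [Dcl x xlb|lbD x Dx u uub].
  rewrite (dm_eq D); have DYx : cl (D `&` Y) x.
    apply: lbound_ubound_in => [z []//|u [uub Yu]].
    (* An upper bound of [D `&` Y] bounds its closure, hence all of [D]. *)
    by apply: xlb; split=> // z /Dcl; apply.
  by apply: cl_mono DYx => z [].
have CY : ubound D `&` Y `<=` Y by move=> z [].
have : ubound (lbound (ubound D `&` Y)) u.
  by apply: (ubound_lbound_in _ CY) => y [/lbD Dy Yy]; apply: uub.
by apply=> y [yub _]; apply: yub.
Qed.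

(** If each D in [S] is generated by [D `&` Y], the cut generated by
    [F `&` Y] already contains every such D, hence also [F]. *)
Lemma range_dm_map_supremum S :
  S `<=` range (@dm_map d L Y) -> supremums S `<=` range (@dm_map d L Y).
Proof.
move=> SK F [Fub Fmin]; apply/range_dm_mapP.
have : F <= dm_cl (F `&` Y).
  apply: Fmin => D SD; rewrite dm_leP.
  have /range_dm_mapP Dcl := SK _ SD.
  apply: subset_trans Dcl _; apply: cl_mono => x [Dx Yx]; split=> //.
  by have := Fub _ SD; rewrite dm_leP; apply.
by rewrite dm_leP.
Qed.

(** Dually, the lower bounds of [ubound F `&` Y] form a cut contained in every
    member of [S], hence in [F]. *)
Lemma range_dm_map_infimum S :
  S `<=` range (@dm_map d L Y) -> infimums S `<=` range (@dm_map d L Y).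
Proof.
move=> SK F [Flb Fmax]; apply/range_dm_map_lboundP.
have : dm_cl (lbound (ubound F `&` Y)) <= F.
  apply: Fmax => D SD; apply: dm_cl_le.
  have /range_dm_map_lboundP lbD := SK _ SD.
  apply: subset_trans lbD; apply: lbound_mono => u [uub Yu]; split=> // x Fx.
  by apply: uub; have := Flb _ SD; rewrite dm_leP; apply.
by rewrite dm_leP => clF x xlb; apply/clF/sub_cl.
Qed.

End Image.

Theorem corollary26 (d : Order.disp_t) (L : latticeType d) (Y : set L)
    (Ysub : is_sublattice Y) (YA : propertyA Y) (YB : propertyB Y) :
  is_regular_sublattice (range (@dm_map d L Y)).
Proof.
apply: dm_regular_of_closed => S.
  exact: range_dm_map_supremum.
exact: range_dm_map_infimum.
Qed.
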